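(* If $G$ is a graph given by a distance model with $0$–$1$ weights of size $m$, then the $c$-Bounded $r$-Scattered Maximal Subset problem on $G$ (with any input subset $X\subseteq V(G)$) can be solved in time $O(cm)$.
   Context: A distance model for $G$ is a weighted directed graph $H$ with $V(G)\subseteq V(H)$ and $\mathrm{dist}_H(x,y)=\mathrm{dist}_G(x,y)$ for all $x,y\in V(G)$; its size is its number of vertices plus edges; here weights are in $\{0,1\}$. A set $S$ of vertices is $r$-scattered if $\mathrm{dist}(x,y)>r$ for all distinct $x,y\in S$. The $c$-Bounded $r$-Scattered Maximal Subset problem: given a graph $G$ and $X\subseteq V(G)$, output $S\subseteq X$ that is $r$-scattered in $G$, has size at most $c$, and is inclusion-wise maximal with these two properties. *)

(* Defs.v *)
From mathcomp Require Import all_boot.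
From mathcomp Require Import boolp.
Set Implicit Arguments.
Unset Strict Implicit.
Unset Printing Implicit Defensive.

Definition walk_of_weight (T : eqType) (e : rel T) (w : T -> T -> nat)
    (x y : T) (k : nat) : Prop :=
  exists p : seq T, [/\ path e x p, last x p = y & sumn (pairmap w x p) = k].

(* None stands for an infinite distance. *)
Definition dist (T : eqType) (e : rel T) (w : T -> T -> nat) (x y : T) :
    option nat :=
  match pselect (exists k, `[< walk_of_weight e w x y k >]) with
  | left ex_walk => Some (ex_minn ex_walk)
  | right _ => None
  end.

Definition dist_gt (d : option nat) (r : nat) : bool :=
  if d is Some k then r < k else true.

(* Only the values of [wt] on arcs are meaningful. *)
Record wdigraph := WDigraph {
  nv : nat;
  arc : rel 'I_nv;
  wt : 'I_nv -> 'I_nv -> nat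
}.

Definition arcs (H : wdigraph) : {set 'I_(nv H) * 'I_(nv H)} :=
  [set a | arc a.1 a.2].

Definition wdigraph_size (H : wdigraph) : nat := nv H + #|arcs H|.

Definition weights01 (H : wdigraph) : Prop :=
  forall x y : 'I_(nv H), arc x y -> wt x y = 0 \/ wt x y = 1.

(* Simple undirected graphs whose vertex set is a subset of [T]. *)
Record graph (T : finType) := Graph {
  vset : {set T};
  adj : rel T;
  adj_sym : symmetric adj;
  adj_irr : irreflexive adj;
  adj_vset : forall x y, adj x y -> (x \in vset) && (y \in vset)
}.

Definition gdist (T : finType) (G : graph T) : T -> T -> option nat :=
  dist (adj G) (fun _ _ => 1).

Definition distance_model (H : wdigraph) (G : graph 'I_(nv H)) : Prop :=
  forall x y, x \in vset G -> y \in vset G ->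
    dist (@arc H) (@wt H) x y = gdist G x y.
Arguments distance_model : clear implicits.

Definition scattered (T : finType) (G : graph T) (r : nat) (S : {set T}) :
    bool :=
  [forall x in S, forall y in S, (x != y) ==> dist_gt (gdist G x y) r].

Definition maximal_scattered (T : finType) (G : graph T) (X : {set T})
    (c r : nat) (S : {set T}) : bool :=
  maxset (fun A : {set T} => [&& A \subset X, scattered G r A & #|A| <= c]) S.

(* The machine model is a unit-cost random-access machine, programmed with
   structured control flow, with registers and finitely many (those a program
   mentions) unbounded arrays, all holding natural numbers.  The only
   arithmetic is successor and truncated predecessor, so a value grows by at
   most one per unit of time beyond the inputs and program constants; hence
   unit cost does not hide arithmetic on long numbers. *)
Inductive expr :=
| Cst of nat
| Reg of nat
| Arr of nat & expr
| Succ of expr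
| Pred of expr.

Inductive test :=
| TestLt of expr & expr
| TestEq of expr & expr.

(* [Store a e1 e2] writes the value of [e2] in cell [e1] of array [a]. *)
Inductive cmd :=
| Skip
| Assign of nat & expr
| Store of nat & expr & expr
| Seq of cmd & cmd
| If of test & cmd & cmd
| While of test & cmd.

Record state := State { regs : nat -> nat; arrs : nat -> nat -> nat }.

Definition set_reg (s : state) (x v : nat) : state :=
  State (fun y => if y == x then v else regs s y) (arrs s).

Definition set_arr (s : state) (a i v : nat) : state :=
  State (regs s)
    (fun b j => if (b == a) && (j == i) then v else arrs s b j).

Fixpoint eval (s : state) (e : expr) : nat :=
  match e with
  | Cst k => k
  | Reg x => regs s x
  | Arr a e1 => arrs s a (eval s e1)
  | Succ e1 => (eval s e1).+1
  | Pred e1 => (eval s e1).-1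
  end.

Definition holds (s : state) (b : test) : bool :=
  match b with
  | TestLt e1 e2 => eval s e1 < eval s e2
  | TestEq e1 e2 => eval s e1 == eval s e2
  end.

Fixpoint ecost (e : expr) : nat :=
  match e with
  | Cst _ | Reg _ => 1
  | Arr _ e1 | Succ e1 | Pred e1 => (ecost e1).+1
  end.

Definition tcost (b : test) : nat :=
  match b with
  | TestLt e1 e2 | TestEq e1 e2 => (ecost e1 + ecost e2).+1
  end.

(* [exec p s t s']: started in state s, p halts in state s' after time t. *)
Inductive exec : cmd -> state -> nat -> state -> Prop :=
| exec_skip s : exec Skip s 1 s
| exec_assign x e s :
    exec (Assign x e) s (ecost e).+1 (set_reg s x (eval s e))
| exec_store a e1 e2 s :
    exec (Store a e1 e2) s (ecost e1 + ecost e2).+1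
      (set_arr s a (eval s e1) (eval s e2))
| exec_seq p q s1 s2 s3 t1 t2 :
    exec p s1 t1 s2 -> exec q s2 t2 s3 -> exec (Seq p q) s1 (t1 + t2) s3
| exec_if_true b p q s s' t :
    holds s b -> exec p s t s' -> exec (If b p q) s (tcost b + t) s'
| exec_if_false b p q s s' t :
    ~~ holds s b -> exec q s t s' -> exec (If b p q) s (tcost b + t) s'
| exec_while_true b p s1 s2 s3 t1 t2 :
    holds s1 b -> exec p s1 t1 s2 -> exec (While b p) s2 t2 s3 ->
    exec (While b p) s1 (tcost b + t1 + t2) s3
| exec_while_false b p s :
    ~~ holds s b -> exec (While b p) s (tcost b) s.

Definition enumerates (T : finType) (s : seq T) (A : {set T}) : Prop :=
  uniq s /\ s =i A.

(* Vertices are represented by their numbers.  Registers 0 to 5 hold the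
   scalar inputs; arrays 0, 1, 2 hold the arc list (tails, heads, weights),
   array 3 lists V(G) and array 4 lists X.  Everything else is 0. *)
Definition input_state (H : wdigraph) (es : seq ('I_(nv H) * 'I_(nv H)))
    (vs xs : seq 'I_(nv H)) (c r : nat) : state :=
  State (nth 0 [:: nv H; size es; size vs; size xs; c; r])
    (fun a => nth 0 (nth [::] [:: [seq val e.1 | e <- es];
                                  [seq val e.2 | e <- es];
                                  [seq wt e.1 e.2 | e <- es];
                                  [seq val v | v <- vs];
                                  [seq val x | x <- xs]] a)).

(* The output is the list of the first [regs s 0] cells of array 0. *)
Definition outputs (n : nat) (s : state) (S : {set 'I_n}) : Prop :=
  exists2 ss : seq 'I_n, enumerates ss S &
    [seq val x | x <- ss] = mkseq (arrs s 0) (regs s 0).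

(* Main.v *)
Require Import Defs.
From mathcomp Require Import all_boot.
From mathcomp Require Import boolp zify.
Set Implicit Arguments.
Unset Strict Implicit.
Unset Printing Implicit Defensive.

(** Greedy selection: scan [X], keep each vertex that is at distance more than
    [r] from all kept ones, and stop after [c] of them.  Each time a vertex is
    kept, a 0-1 breadth-first search of the distance model, truncated at depth
    [r], marks its ball in time linear in the size of the model, because every
    arc is scanned at most once; the search needs no reset, since a mark is the
    number of the search that made it.  If fewer than [c] vertices are kept,
    all of [X] is marked, hence the kept set is maximal.  Distances in the
    model are symmetric on V(G), so forward searches suffice. *)

(** * Executions with cost *)

(** Total correctness with the running time visible to the postcondition, so that programs can be
    executed symbolically from the front. *)
Definition runs (p : cmd) (s : state) (Q : nat -> state -> Prop) : Prop :=
  exists t s', exec p s t s' /\ Q t s'.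

Lemma runs_mono p s (Q Q' : nat -> state -> Prop) :
  runs p s Q -> (forall t s', Q t s' -> Q' t s') -> runs p s Q'.
Proof. by move=> [t [s' [ex q]]] QQ'; exists t, s'; split=> //; apply: QQ'. Qed.

Lemma runs_skip s (Q : nat -> state -> Prop) : Q 1 s -> runs Skip s Q.
Proof. by move=> q; exists 1, s; split=> //; constructor. Qed.

Lemma runs_assign x e s (Q : nat -> state -> Prop) :
  Q (ecost e).+1 (set_reg s x (eval s e)) -> runs (Assign x e) s Q.
Proof. by move=> q; do 2!eexists; split; [constructor | exact: q]. Qed.

Lemma runs_store a e1 e2 s (Q : nat -> state -> Prop) :
  Q (ecost e1 + ecost e2).+1 (set_arr s a (eval s e1) (eval s e2)) ->
  runs (Store a e1 e2) s Q.
Proof. by move=> q; do 2!eexists; split; [constructor | exact: q]. Qed.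

Lemma runs_seq p q s (Q : nat -> state -> Prop) :
  runs p s (fun t s1 => runs q s1 (fun t' => Q (t + t'))) ->
  runs (Seq p q) s Q.
Proof.
move=> [t [s1 [ex1 [t' [s2 [ex2 q2]]]]]].
by exists (t + t'), s2; split=> //; apply: exec_seq ex1 ex2.
Qed.

Lemma runs_if b p q s (Q : nat -> state -> Prop) :
  (holds s b -> runs p s (fun t => Q (tcost b + t))) ->
  (~~ holds s b -> runs q s (fun t => Q (tcost b + t))) ->
  runs (If b p q) s Q.
Proof.
case: (boolP (holds s b)) => hb.
- move=> /(_ isT) [t [s' [ex q']]] _.
  by exists (tcost b + t), s'; split=> //; apply: exec_if_true.
- move=> _ /(_ isT) [t [s' [ex q']]].
  by exists (tcost b + t), s'; split=> //; apply: exec_if_false.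
Qed.

(* [I n s]: the invariant holds in [s] and the remaining iterations are paid
   for by the potential [n]. *)
Lemma runs_while b p (I : nat -> state -> Prop) n s :
  I n s ->
  (forall n s, I n s -> holds s b ->
     runs p s (fun t s' => exists2 n', tcost b + t + n' <= n & I n' s')) ->
  0 < tcost b ->
  runs (While b p) s (fun t s' =>
    t <= n + tcost b /\ exists2 n', I n' s' & ~~ holds s' b).
Proof.
move=> + step b_gt0; elim/ltn_ind: n s => n IH s Is.
case: (boolP (holds s b)) => hb; last first.
  exists (tcost b), s; split; first by constructor.
  by split; [lia | exists n].
have [t [s1 [ex1 [n' le_n' I1]]]] := step _ _ Is hb.
(* The test costs at least 1, so the potential strictly decreases and the same induction yields
   termination. *)
have lt_n' : n' < n by lia.
have [t' [s2 [ex2 [le_t' fin]]]] := IH _ lt_n' _ I1.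
exists (tcost b + t + t'), s2; split; first exact: exec_while_true ex1 ex2.
by split; [lia |].
Qed.

(** * Linked lists, stacks and queues in arrays *)

(* The pointer 0 is null and the pointer [e.+1] stands for the item [e]. *)
Fixpoint chain (next : nat -> nat) (p : nat) (L : seq nat) : Prop :=
  if L is e :: L' then p = e.+1 /\ chain next (next p) L' else p = 0.

Fixpoint stack (f : nat -> nat) (n : nat) (Z : seq nat) : Prop :=
  if Z is v :: Z' then [/\ 0 < n, f n.-1 = v & stack f n.-1 Z'] else n = 0.

(** Two parallel arrays hold the components of the items; cells are never reused, so nothing wraps
    around. *)
Fixpoint queue (f g : nat -> nat) (h t : nat) (Q : seq (nat * nat)) : Prop :=
  if Q is u :: Q' then [/\ h < t, f h = u.1, g h = u.2 & queue f g h.+1 t Q']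
  else h = t.

Lemma eq_chain f g p L :
  (forall e, e \in L -> f e.+1 = g e.+1) -> chain f p L -> chain g p L.
Proof.
elim: L p => //= e L IH p fg [-> cL]; split=> //.
rewrite -fg ?inE ?eqxx //; apply: IH cL => e' Le'.
by apply: fg; rewrite inE Le' orbT.
Qed.

Lemma eq_stack f g n Z :
  (forall i, i < n -> f i = g i) -> stack f n Z -> stack g n Z.
Proof.
elim: Z n => //= v Z IH n fg [n_gt0 fv sZ].
split=> //; first by rewrite -fg //; lia.
by apply: IH sZ => i lt_i; apply: fg; lia.
Qed.

Lemma stack_push f n Z v :
  stack f n Z -> stack (fun i => if i == n then v else f i) n.+1 (v :: Z).
Proof.
move=> sZ /=; split=> //; first by rewrite eqxx.
by apply: eq_stack sZ => i lt_i; rewrite ifN //; lia.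
Qed.

Lemma queue_push f g h t Q v k :
  queue f g h t Q ->
  queue (fun i => if i == t then v else f i)
        (fun i => if i == t then k else g i) h t.+1 (rcons Q (v, k)).
Proof.
elim: Q h => /= [h -> | u Q IH h [lt_ht fu gu qQ]].
  by rewrite eqxx; split.
have -> : (h == t) = false by lia.
by split=> //; [lia | apply: IH].
Qed.

(** * Bounded 0-1 breadth-first search *)

(** The decreasing order is the one obtained by prepending the arcs one by one. *)
Fixpoint out_arcs (T : nat -> nat) (j v : nat) : seq nat :=
  if j is j'.+1 then
    if T j' == v then j' :: out_arcs T j' v else out_arcs T j' v
  else [::].

Lemma mem_out_arcs T j v e :
  (e \in out_arcs T j v) = (e < j) && (T e == v).
Proof.
elim: j => [|j IH] //=; case: ifP => Tj; rewrite ?inE IH ltnS [e <= j]leq_eqVlt.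
- by case: (eqVneq e j) => [->|] //=; rewrite Tj.
- by case: (eqVneq e j) => [->|] //=; rewrite Tj ltnn.
Qed.

Definition visit (D : nat -> option nat) (v d : nat) : nat -> option nat :=
  fun u => if u == v then Some d else D u.

Fixpoint unseen_arcs (T : nat -> nat) (D : nat -> option nat) (j : nat) : nat :=
  if j is j'.+1 then (D (T j') == None) + unseen_arcs T D j' else 0.

(** The arcs out of [v] pass from unseen to waiting; as the sum is constant, each arc is charged
    once. *)
Lemma unseen_arcs_visit T D v d j : D v = None ->
  unseen_arcs T (visit D v d) j + size (out_arcs T j v) = unseen_arcs T D j.
Proof.
move=> Dv; elim: j => [|j IH] //=; rewrite {1}/visit.
by case: (eqVneq (T j) v) => [->|_] /=; rewrite ?Dv /=; lia.
Qed.

Lemma unseen_arcs_le T D j : unseen_arcs T D j <= j.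
Proof. by elim: j => //= j IH; case: (_ == _); lia. Qed.

(** * Transitions of the abstract search *)

Section Search.

Variables (m : nat) (T Hd W : nat -> nat) (r x : nat).
(** Stands for the existence of a walk of the given weight from the source; closure under arcs
    suffices for soundness. *)
Variable reach : nat -> nat -> Prop.
Hypothesis reach_arc : forall e k,
  e < m -> reach (T e) k -> reach (Hd e) (k + W e).

(* The vertex [v] has been, or is going to be, visited at distance at most [b]
   from the source. *)
Definition covered (Z : seq nat) (Q : seq (nat * nat)) (d : nat) (D : nat -> option nat)
    (v b : nat) : Prop :=
  [\/ exists2 k, D v = Some k & k <= b,
      v \in Z /\ d <= b | exists2 k, (v, k) \in Q & k <= b].

(* [L]: the arcs out of the last visited vertex still to be scanned; [Z]: the
   vertices to be visited at the current distance [d]; [Q]: those to be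
   visited later, with their distances, which are [d] or [d.+1]; [D]: the
   distances of the visited vertices. *)
Record search_inv (L Z : seq nat) Q d D : Prop := SearchInv {
  inv_r : d <= r;
  inv_D : forall v k, D v = Some k -> reach v k /\ k <= d;
  inv_Z : forall v, v \in Z -> reach v d;
  inv_Q : forall v k, (v, k) \in Q -> [/\ reach v k, d <= k, k <= d.+1 & k <= r];
  inv_sorted : pairwise leq [seq u.2 | u <- Q];
  inv_L : forall e, e \in L -> e < m /\ D (T e) = Some d;
  inv_src : covered Z Q d D x 0;
  inv_arcs : forall e k, e < m -> D (T e) = Some k -> k + W e <= r ->
    e \in L \/ covered Z Q d D (Hd e) (k + W e)
}.

Lemma search_init : reach x 0 ->
  search_inv [::] [::] [:: (x, 0)] 0 (fun=> None).
Proof.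
move=> rx; split=> //.
- by move=> v k; rewrite inE => /eqP[-> ->].
- by apply: Or33; exists 0; rewrite ?inE.
Qed.

Lemma covered_push Z Q d D u v b :
  covered Z Q d D v b -> covered (u :: Z) Q d D v b.
Proof.
case=> [c|[Zv le_db]|c]; [exact: Or31| |exact: Or33].
by apply: Or32; rewrite inE Zv orbT.
Qed.

Lemma covered_enqueue Z Q d D u v b :
  covered Z Q d D v b -> covered Z (rcons Q u) d D v b.
Proof.
case=> [c|c|[k Qk le_kb]]; [exact: Or31|exact: Or32|].
by apply: Or33; exists k; rewrite // mem_rcons inE Qk orbT.
Qed.

Lemma search_scan0 e L Z Q d D : W e = 0 ->
  search_inv (e :: L) Z Q d D -> search_inv L (Hd e :: Z) Q d D.
Proof.
move=> We [dr iD iZ iQ iS iL isrc ia].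
have [lt_em De] := iL _ (mem_head _ _).
split=> //.
- move=> v; rewrite inE => /predU1P[->|/iZ //].
  by rewrite -[d]addn0 -We; apply: reach_arc => //; have [] := iD _ _ De.
- by move=> f Lf; apply: iL; rewrite inE Lf orbT.
- exact: covered_push.
- move=> f k lt_fm Df le_r; have [] := ia f k lt_fm Df le_r.
    rewrite inE => /predU1P[eq_f|]; last by left.
    right; apply: Or32; rewrite eq_f mem_head; split=> //.
    by move: Df; rewrite eq_f De => -[->]; lia.
  by right; apply: covered_push.
Qed.

(** No queued distance exceeds [d.+1], so appending at the rear keeps the queue sorted. *)
Lemma search_scan1 e L Z Q d D : W e = 1 -> d < r ->
  search_inv (e :: L) Z Q d D -> search_inv L Z (rcons Q (Hd e, d.+1)) d D.
Proof.
move=> We lt_dr [dr iD iZ iQ iS iL isrc ia].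
have [lt_em De] := iL _ (mem_head _ _).
split=> //.
- move=> v k; rewrite mem_rcons inE => /predU1P[[-> ->]|/iQ //].
  split=> //; rewrite -addn1 -We; apply: reach_arc => //.
  by have [] := iD _ _ De.
- rewrite map_rcons pairwise_rcons iS andbT.
  by apply/allP=> _ /mapP[[v k] /iQ[_ _ le_k _] ->].
- by move=> f Lf; apply: iL; rewrite inE Lf orbT.
- exact: covered_enqueue.
- move=> f k lt_fm Df le_r; have [] := ia f k lt_fm Df le_r.
    rewrite inE => /predU1P[eq_f|]; last by left.
    right; apply: Or33; exists d.+1; first by rewrite eq_f mem_rcons mem_head.
    by move: Df; rewrite eq_f De => -[<-]; lia.
  by right; apply: covered_enqueue.
Qed.

(** The head would lie beyond [r], where [inv_arcs] demands nothing. *)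
Lemma search_scan_far e L Z Q d D : W e = 1 -> r <= d ->
  search_inv (e :: L) Z Q d D -> search_inv L Z Q d D.
Proof.
move=> We le_rd [dr iD iZ iQ iS iL isrc ia].
have [lt_em De] := iL _ (mem_head _ _).
split=> //; first by move=> f Lf; apply: iL; rewrite inE Lf orbT.
move=> f k lt_fm Df le_r; have [] := ia f k lt_fm Df le_r; last by right.
rewrite inE => /predU1P[eq_f|]; last by left.
by move: Df le_r; rewrite eq_f De => -[<-]; lia.
Qed.

(** The queue is sorted and its distances are at most [d.+1], so the others lie between [k] and
    [k.+1]. Passing [v] through the stack lets both kinds of visit share one argument. *)
Lemma search_dequeue v k Q d D :
  search_inv [::] [::] ((v, k) :: Q) d D -> search_inv [::] [:: v] Q k D.
Proof.
move=> [dr iD iZ iQ iS iL isrc ia].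
have [rv le_dk le_kd le_kr] := iQ _ _ (mem_head _ _).
have deq u b : covered [::] ((v, k) :: Q) d D u b -> covered [:: v] Q k D u b.
  case=> [c|[]//|[k' + le_k']]; first exact: Or31.
  rewrite inE => /predU1P[[-> eq_k]|Qk]; last by apply: Or33; exists k'.
  by apply: Or32; rewrite mem_head -eq_k.
move: iS => /= /andP[/allP le_k iS].
split=> //.
- by move=> u k' /iD[ru le]; split=> //; lia.
- by move=> u; rewrite inE => /eqP->.
- move=> u k' Qu; have [|ru _ le1 le2] := iQ u k'; first by rewrite inE Qu orbT.
  by have := le_k k' (map_f snd Qu); split=> //; lia.
- exact: deq.
- move=> f k' lt_fm Df le_r; have [//|] := ia f k' lt_fm Df le_r.
  by right; apply: deq.
Qed.

(** Visited vertices have recorded distance at most [d], so [D] covers whatever this stack entry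
    covered. *)
Lemma search_pop_old v Z Q d D : D v <> None ->
  search_inv [::] (v :: Z) Q d D -> search_inv [::] Z Q d D.
Proof.
move=> Dv [dr iD iZ iQ iS iL isrc ia].
have pop u b : covered (v :: Z) Q d D u b -> covered Z Q d D u b.
  case=> [c|[+ le_db]|c]; [exact: Or31| |exact: Or33].
  rewrite inE => /predU1P[->|Zu]; last exact: Or32.
  case Dvk: (D v) Dv => [k|] // _; have [_ le_kd] := iD _ _ Dvk.
  by apply: Or31; exists k => //; lia.
split=> //.
- by move=> u Zu; apply: iZ; rewrite inE Zu orbT.
- exact: pop.
- move=> f k' lt_fm Df le_r; have [//|] := ia f k' lt_fm Df le_r.
  by right; apply: pop.
Qed.

Lemma search_pop_new v Z Q d D : D v = None ->
  search_inv [::] (v :: Z) Q d D ->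
  search_inv (out_arcs T m v) Z Q d (visit D v d).
Proof.
move=> Dv [dr iD iZ iQ iS iL isrc ia].
have pop u b :
    covered (v :: Z) Q d D u b -> covered Z Q d (visit D v d) u b.
  rewrite /covered /visit => -[[k Du le_kb]|[+ le_db]|c]; last exact: Or33.
    by apply: Or31; exists k => //; case: eqP => // eq_u; rewrite eq_u Dv in Du.
  rewrite inE => /predU1P[->|Zu]; last exact: Or32.
  by apply: Or31; exists d => //; rewrite eqxx.
split=> //.
- move=> u k; rewrite /visit; case: eqP => [-> [<-]|_ /iD //].
  by split=> //; apply: iZ; rewrite mem_head.
- by move=> u Zu; apply: iZ; rewrite inE Zu orbT.
- by move=> e; rewrite mem_out_arcs /visit => /andP[-> ->].
- exact: pop.
- move=> e k lt_em; rewrite {1}/visit; case: ifP => [eq_v _ _|_ De le_r].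
    by left; rewrite mem_out_arcs lt_em.
  by have [//|] := ia e k lt_em De le_r; right; apply: pop.
Qed.

End Search.
(** * The search program *)

Definition visit_cmd : cmd :=
  If (TestEq (Arr 7 (Reg 12)) (Reg 0)) Skip
    (Seq (Store 7 (Reg 12) (Reg 0)) (Assign 7 (Arr 5 (Reg 12)))).

Definition scan_cmd : cmd :=
  Seq
    (If (TestEq (Arr 2 (Pred (Reg 7))) (Cst 0))
      (Seq (Store 8 (Reg 8) (Arr 1 (Pred (Reg 7)))) (Assign 8 (Succ (Reg 8))))
      (If (TestLt (Reg 11) (Reg 5))
        (Seq (Store 9 (Reg 10) (Arr 1 (Pred (Reg 7))))
          (Seq (Store 10 (Reg 10) (Succ (Reg 11)))
               (Assign 10 (Succ (Reg 10)))))
        Skip))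
    (Assign 7 (Arr 6 (Reg 7))).

Definition pop_cmd : cmd :=
  Seq (Assign 8 (Pred (Reg 8))) (Seq (Assign 12 (Arr 8 (Reg 8))) visit_cmd).

Definition dequeue_cmd : cmd :=
  Seq (Assign 12 (Arr 9 (Reg 9)))
    (Seq (Assign 11 (Arr 10 (Reg 9)))
      (Seq (Assign 9 (Succ (Reg 9))) visit_cmd)).

Definition step_cmd : cmd :=
  If (TestLt (Cst 0) (Reg 7)) scan_cmd
    (If (TestLt (Cst 0) (Reg 8)) pop_cmd
      (If (TestLt (Reg 9) (Reg 10)) dequeue_cmd (Assign 13 (Cst 0)))).

(* Registers: 7 next arc to scan, 8 height of the stack (array 8), 9 and 10
   front and rear of the queue (vertices in array 9, distances in array 10),
   11 current distance, 12 vertex to visit, 13 whether the search goes on.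
   Arrays 5 and 6 hold the adjacency lists; a vertex is visited when its cell
   in array 7 holds the number of the search, which is in register 0. *)
Definition search_cmd (x : expr) : cmd :=
  Seq (Store 9 (Cst 0) x) (Seq (Store 10 (Cst 0) (Cst 0))
  (Seq (Assign 7 (Cst 0)) (Seq (Assign 8 (Cst 0))
  (Seq (Assign 9 (Cst 0)) (Seq (Assign 10 (Cst 1))
  (Seq (Assign 11 (Cst 0)) (Seq (Assign 13 (Cst 1))
  (While (TestLt (Cst 0) (Reg 13)) step_cmd)))))))).

(** * The program follows the abstract search in linear time *)

Section SearchProgram.

(** The tails [T] are kept apart from array 0, which the caller overwrites with its output. *)
Variables (m : nat) (T : nat -> nat) (s0 : state) (x : nat).
Variable reach : nat -> nat -> Prop.

Local Notation Hd := (arrs s0 1).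
Local Notation W := (arrs s0 2).
Local Notation r := (regs s0 5).

Hypothesis reach_arc : forall e k,
  e < m -> reach (T e) k -> reach (Hd e) (k + W e).
Hypothesis W01 : forall e, e < m -> W e = 0 \/ W e = 1.
Hypothesis adjacency : forall v,
  chain (arrs s0 6) (arrs s0 5 v) (out_arcs T m v).
Hypothesis stamp_fresh : forall v, arrs s0 7 v < regs s0 0.

Definition frame (s : state) : Prop :=
  (forall j, j < 7 -> regs s j = regs s0 j) /\
  (forall a, a < 7 -> arrs s a = arrs s0 a).

Definition stamps (s : state) (D : nat -> option nat) : Prop :=
  forall v, arrs s 7 v = if D v is Some _ then regs s0 0 else arrs s0 7 v.

(** An arc is worth 100: 50 for its scan and 50 for the item it may push, whose removal and visit
    that pays for. The flag [b] pays for the last iteration. *)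
Definition search_cost (L Z : seq nat) (Q : seq (nat * nat)) D b : nat :=
  100 * (size L + unseen_arcs T D m) + 50 * (size Z + size Q + b).

Definition search_state (n : nat) (s : state) : Prop :=
  exists L Z Q D,
    [/\ search_inv m T Hd W r x reach L Z Q (regs s 11) D,
        [/\ chain (arrs s0 6) (regs s 7) L, stack (arrs s 8) (regs s 8) Z
          & queue (arrs s 9) (arrs s 10) (regs s 9) (regs s 10) Q],
        frame s /\ stamps s D,
        regs s 13 = 0 -> [/\ L = [::], Z = [::] & Q = [::]]
      & search_cost L Z Q D (0 < regs s 13) <= n].

Lemma frame_reg s j v : 7 <= j -> frame s -> frame (set_reg s j v).
Proof.
move=> le7 [fr fa]; split=> // i lt_i /=; rewrite -fr //.
by case: eqP => // ?; lia.
Qed.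

Lemma frame_arr s a i v : 7 <= a -> frame s -> frame (set_arr s a i v).
Proof.
move=> le7 [fr fa]; split=> // b lt_b /=; rewrite -fa //.
by apply/funext=> j; case: eqP => // ?; lia.
Qed.

(** The machine has already removed [v] from its stack or queue, while the invariant still has it on
    top of the stack. *)
Lemma visit_runs v Z Q D n s :
  search_inv m T Hd W r x reach [::] (v :: Z) Q (regs s 11) D ->
  regs s 7 = 0 -> stack (arrs s 8) (regs s 8) Z ->
  queue (arrs s 9) (arrs s 10) (regs s 9) (regs s 10) Q ->
  frame s -> stamps s D -> regs s 12 = v -> 0 < regs s 13 ->
  search_cost [::] Z Q D true <= n ->
  runs visit_cmd s (fun t s' => t <= 12 /\ search_state n s').
Proof.
move=> inv s7 sZ qQ fr st s12 s13 le_n.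
have [fr1 fr2] := fr.
apply: runs_if => /= [/eqP|/eqP]; rewrite s12 fr1 // => st_v.
- apply: runs_skip; split=> //.
  (* An unvisited vertex keeps its old stamp, which is below the number of this search. *)
  have Dv : D v <> None.
    by move=> Dv; have := stamp_fresh v; rewrite -st_v st Dv ltnn.
  exists [::], Z, Q, D; split=> //; first exact: search_pop_old inv.
  + by move=> s13_0; rewrite s13_0 in s13.
  + by rewrite s13.
- have Dv : D v = None.
    by have := st v; case: (D v) => // k eq_v; case: st_v.
  apply: runs_seq; apply: runs_store; apply: runs_assign; split=> //=.
  rewrite s12; exists (out_arcs T m v), Z, Q, (visit D v (regs s 11)).
  split=> //=.
  + exact: search_pop_new inv.
  + by split=> //; rewrite fr2.
  + split; first by apply: frame_reg => //; exact: frame_arr.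
    by move=> u /=; rewrite /visit; case: eqP => // _; rewrite fr1.
  + by move=> s13_0; rewrite s13_0 in s13.
  + move: le_n; rewrite /search_cost s13 /=.
    by have := unseen_arcs_visit T (regs s 11) m Dv; lia.
Qed.

(** Each branch is a transition of the abstract search and frees 50 units of potential; the 3 is the
    cost of the loop test. *)
Lemma step_runs n s : search_state n s -> 0 < regs s 13 ->
  runs step_cmd s (fun t s' =>
    exists2 n', 3 + t + n' <= n & search_state n' s').
Proof.
move=> [L [Z [Q [D [inv [cL sZ qQ] [fr st] _]]]]] + s13; rewrite s13 => le_n.
have [fr1 fr2] := fr.
apply: runs_if => /= h7.
  case: L cL inv le_n => [|e L] /= cL inv le_n; first by rewrite cL in h7.
  case: cL => s7 cL.
  have [lt_em _] := inv_L inv (mem_head _ _).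
  apply: runs_seq; apply: runs_if; rewrite /= s7 /= fr2 // => We.
  - move/eqP: We => We.
    apply: runs_seq; apply: runs_store; apply: runs_assign; apply: runs_assign.
    exists (n - 50); first by move: le_n; rewrite /search_cost /=; lia.
    exists L, (Hd e :: Z), Q, D; split=> //=.
    + exact: search_scan0 inv.
    + split=> //; first by rewrite s7 fr2 //; rewrite s7 in cL.
      by rewrite s7 fr2 //; apply: stack_push.
    + by split=> //; do !apply: frame_reg => //; apply: frame_arr.
    + by move=> s13_0; rewrite s13_0 in s13.
    + by move: le_n; rewrite /search_cost s13 /=; lia.
  - have {}We : W e = 1 by case: (W01 lt_em) We => ->.
    apply: runs_if => /=; rewrite (fr1 5) // => h11.
    + apply: runs_seq; apply: runs_store; apply: runs_seq; apply: runs_store.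
      apply: runs_assign; apply: runs_assign.
      exists (n - 50); first by move: le_n; rewrite /search_cost /=; lia.
      exists L, Z, (rcons Q (Hd e, (regs s 11).+1)), D; split=> //=.
      * exact: search_scan1 inv.
      * split=> //; first by rewrite s7 fr2 //; rewrite s7 in cL.
        by rewrite s7 fr2 //; apply: queue_push.
      * by split=> //; do !apply: frame_reg => //; do !apply: frame_arr => //.
      * by move=> s13_0; rewrite s13_0 in s13.
      * by move: le_n; rewrite /search_cost s13 size_rcons /=; lia.
    + apply: runs_skip; apply: runs_assign.
      exists (n - 50); first by move: le_n; rewrite /search_cost /=; lia.
      exists L, Z, Q, D; split=> //=.
      * by apply: search_scan_far inv => //; lia.
      * by split=> //; rewrite s7 fr2 //; rewrite s7 in cL.
      * by split; first exact: frame_reg.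
      * by move=> s13_0; rewrite s13_0 in s13.
      * by move: le_n; rewrite /search_cost s13 /=; lia.
have s7 : regs s 7 = 0 by lia.
have {cL} L0 : L = [::] by case: L cL {inv le_n} => //= e L []; lia.
subst L.
apply: runs_if => /= h8.
  case: Z sZ inv le_n => [|v Z] /= sZ inv le_n; first by rewrite sZ in h8.
  case: sZ => _ s8 sZ.
  apply: runs_seq; apply: runs_assign; apply: runs_seq; apply: runs_assign.
  apply: (runs_mono (visit_runs (v := v) (Z := Z) (Q := Q) (D := D)
                       (n := n - 50) _ _ _ _ _ _ _ _ _)) => //=.
  - by do !apply: frame_reg => //.
  - by move: le_n; rewrite /search_cost /=; lia.
  - move=> t s' [le_t ss]; exists (n - 50) => //.
    by move: le_n; rewrite /search_cost /=; lia.
have s8 : regs s 8 = 0 by lia.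
have {sZ} Z0 : Z = [::] by case: Z sZ {inv le_n} => //= v Z []; lia.
subst Z.
apply: runs_if => /= h9.
  case: Q qQ inv le_n => [|[v k] Q] /= qQ inv le_n.
    by rewrite qQ ltnn in h9.
  case: qQ => _ s9 s10 qQ.
  apply: runs_seq; apply: runs_assign; apply: runs_seq; apply: runs_assign.
  apply: runs_seq; apply: runs_assign.
  apply: (runs_mono (visit_runs (v := v) (Z := [::]) (Q := Q) (D := D)
                       (n := n - 50) _ _ _ _ _ _ _ _ _)) => //=.
  - by rewrite s10; apply: search_dequeue inv.
  - by do !apply: frame_reg => //.
  - by move: le_n; rewrite /search_cost /=; lia.
  - move=> t s' [le_t ss]; exists (n - 50) => //.
    by move: le_n; rewrite /search_cost /=; lia.
case: Q qQ inv le_n => [|u Q] /= qQ inv le_n; last by case: qQ; lia.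
apply: runs_assign.
exists (n - 50); first by move: le_n; rewrite /search_cost /=; lia.
exists [::], [::], [::], D; split=> //=.
- by split; first exact: frame_reg.
- by move: le_n; rewrite /search_cost /=; lia.
Qed.

Lemma search_runs ex :
  eval s0 ex = x -> reach x 0 ->
  runs (search_cmd ex) s0 (fun t s => t <= 100 * m + 150 + ecost ex /\
    exists2 D, frame s /\ stamps s D &
      exists d, search_inv m T Hd W r x reach [::] [::] [::] d D).
Proof.
move=> ex_x rx; rewrite /search_cmd.
do 2!(apply: runs_seq; apply: runs_store).
do 6!(apply: runs_seq; apply: runs_assign).
set s1 := set_reg _ 13 _.
(* At most 100 for each arc, 50 for the queued source and 50 for the last iteration. *)
have I1 : search_state (100 * m + 100) s1.
  exists [::], [::], [:: (x, 0)], (fun=> None); split=> //=.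
  - exact: search_init.
  - by split=> //; do !apply: frame_reg => //; do !apply: frame_arr => //.
  - by rewrite /search_cost /=; have := unseen_arcs_le T (fun=> None) m; lia.
apply: (runs_mono (runs_while I1 _ _)) => //=.
  by move=> n s ss h; apply: step_runs.
move=> t s [le_t [n [L [Z [Q [D [inv _ [fr st] fin _]]]]] s13]].
split; first by lia.
exists D => //; exists (regs s 11).
have /fin[eL eZ eQ] : regs s 13 = 0 by lia.
by subst.
Qed.

End SearchProgram.

(** * Distances *)

Definition near (V : eqType) (e : rel V) (w : V -> V -> nat) (r : nat)
    (x y : V) : Prop :=
  exists2 k, k <= r & walk_of_weight e w x y k.

(** A minimum is at most [r] exactly when some walk weighs at most [r]; distances are handled
    through walks from here on. *)
Lemma dist_gtPn (V : eqType) (e : rel V) (w : V -> V -> nat) r x y :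
  reflect (near e w r x y) (~~ dist_gt (dist e w x y) r).
Proof.
rewrite /dist; case: pselect => [ex_walk|no_walk] /=.
- case: ex_minnP => k /asboolP wk min_k; rewrite -leqNgt.
  apply: (iffP idP) => [le_kr|[k' le_k'r wk']]; first by exists k.
  by apply: leq_trans le_k'r; apply: min_k; apply/asboolP.
- apply: ReflectF => -[k _ wk]; apply: no_walk.
  by exists k; apply/asboolP.
Qed.

Lemma near_refl (V : eqType) (e : rel V) w r x : near e w r x x.
Proof. by exists 0 => //; exists [::]. Qed.

Lemma sumn_pairmap1 (V : Type) (x : V) p :
  sumn (pairmap (fun _ _ => 1) x p) = size p.
Proof. by elim: p x => //= y p IH x; rewrite IH. Qed.

(** Walks are reversed in [G], since the arcs of a model need not be symmetric. *)
Lemma near_adj_sym (V : finType) (G : graph V) r x y :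
  near (adj G) (fun _ _ => 1) r x y -> near (adj G) (fun _ _ => 1) r y x.
Proof.
move=> [k le_kr [p [px <- def_k]]].
move: le_kr; rewrite -def_k sumn_pairmap1 => le_pr.
exists (size p) => //; exists (rev (belast x p)); split.
- by rewrite rev_path; rewrite (eq_path (e' := adj G)) // => a b; rewrite adj_sym.
- by case: p {px def_k le_pr} => //= z p; rewrite rev_cons last_rcons.
- by rewrite sumn_pairmap1 size_rev size_belast.
Qed.

(** * The greedy program *)

(* Array 5 maps a vertex to the head of its list of arcs, array 6 a pointer to
   the next one. *)
Definition build_cmd : cmd :=
  While (TestLt (Reg 6) (Reg 1))
    (Seq (Store 6 (Succ (Reg 6)) (Arr 5 (Arr 0 (Reg 6))))
    (Seq (Store 5 (Arr 0 (Reg 6)) (Succ (Reg 6)))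
         (Assign 6 (Succ (Reg 6))))).

(** Each arc is prepended to the list of its tail. Its pointer cell is new, as the lists so far
    contain only smaller arc numbers. *)
Lemma build_runs s0 : regs s0 6 = 0 -> (forall v, arrs s0 5 v = 0) ->
  runs build_cmd s0 (fun t s =>
    [/\ t <= 30 * regs s0 1 + 3,
        forall j, j != 6 -> regs s j = regs s0 j,
        forall a, a != 5 -> a != 6 -> arrs s a = arrs s0 a
      & forall v,
          chain (arrs s 6) (arrs s 5 v) (out_arcs (arrs s0 0) (regs s0 1) v)]).
Proof.
move=> s6 s5.
pose I n s :=
  [/\ forall j, j != 6 -> regs s j = regs s0 j,
      forall a, a != 5 -> a != 6 -> arrs s a = arrs s0 a,
      forall v, chain (arrs s 6) (arrs s 5 v) (out_arcs (arrs s0 0) (regs s 6) v),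
      regs s 6 <= regs s0 1
    & 30 * (regs s0 1 - regs s 6) <= n].
have I0 : I (30 * regs s0 1) s0.
  by split=> //; rewrite s6 ?subn0 // => v; rewrite /= s5.
apply: (runs_mono (runs_while I0 _ _)) => //=; last first.
  move=> t s [le_t [n [fr fa ch le6 _]]]; rewrite (fr 1) // => h6.
  split=> //; have <- : regs s 6 = regs s0 1 by lia.
  exact: ch.
move=> n s [fr fa ch le6 le_n]; rewrite (fr 1) // => h6.
apply: runs_seq; apply: runs_store; apply: runs_seq; apply: runs_store.
apply: runs_assign; exists (n - 30); rewrite /=; first by lia.
have a0 : arrs s 0 = arrs s0 0 by apply: fa.
split=> /=; [by move=> j n6; rewrite ifN //; apply: fr| | |by lia|by lia].
- by move=> a n5 n6; rewrite (negPf n5) (negPf n6) /=; apply: fa.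
- move=> v; rewrite a0 eq_sym; case: eqP => [<-|_] /=; last first.
    apply: eq_chain (ch v) => e; rewrite mem_out_arcs => /andP[lt_e _].
    by rewrite ifN //; lia.
  split=> //; rewrite eqxx.
  apply: eq_chain (ch _) => e; rewrite mem_out_arcs => /andP[lt_e _].
  by rewrite ifN //; lia.
Qed.

(* Once the adjacency lists are built, the tails in array 0 are not needed and
   the output overwrites them.  Setting register 6 to [|X|] leaves the loop. *)
Definition greedy_step_cmd : cmd :=
  Seq
    (If (TestEq (Arr 7 (Arr 4 (Reg 6))) (Cst 0))
      (Seq (Store 0 (Reg 0) (Arr 4 (Reg 6)))
      (Seq (Assign 0 (Succ (Reg 0)))
           (search_cmd (Arr 4 (Reg 6)))))
      Skip)
    (If (TestEq (Reg 0) (Reg 4)) (Assign 6 (Reg 3)) (Assign 6 (Succ (Reg 6)))).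

(** For [c] equal to 0 only constant time is allowed, so even building the lists must be avoided. *)
Definition greedy_cmd : cmd :=
  Seq (Assign 0 (Cst 0))
    (If (TestLt (Cst 0) (Reg 4))
      (Seq build_cmd
      (Seq (Assign 6 (Cst 0))
           (While (TestLt (Reg 6) (Reg 3)) greedy_step_cmd)))
      Skip).

(** * Correctness and cost of the greedy selection *)

Section Greedy.

Variables (H : wdigraph) (G : graph 'I_(nv H)).
Hypotheses (H01 : weights01 H) (HG : distance_model H G).
Variables (c r : nat) (X : {set 'I_(nv H)}).
Hypothesis XG : X \subset vset G.
Variables (es : seq ('I_(nv H) * 'I_(nv H))) (vs xs : seq 'I_(nv H)).
Hypotheses (es_arcs : enumerates es (arcs H)) (xs_X : enumerates xs X).

Local Notation hnear := (near (@Defs.arc H) (@wt H) r).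
Local Notation gnear := (near (adj G) (fun _ _ => 1) r).
Local Notation s0 := (input_state es vs xs c r).
Local Notation m := (size es).

Lemma hnearE x y : x \in X -> y \in X -> hnear x y <-> gnear x y.
Proof.
move=> Xx Xy; have := HG (subsetP XG _ Xx) (subsetP XG _ Xy); rewrite /gdist => eq_d.
by split=> /dist_gtPn; [rewrite eq_d | rewrite -eq_d] => /dist_gtPn.
Qed.

Definition hreach (x : 'I_(nv H)) (v k : nat) : Prop :=
  exists2 y : 'I_(nv H), val y = v &
    walk_of_weight (@Defs.arc H) (@wt H) x y k.

Lemma input_arc e : e < m -> exists y z : 'I_(nv H),
  [/\ Defs.arc y z, arrs s0 0 e = y, arrs s0 1 e = z & arrs s0 2 e = wt y z].
Proof.
move=> lt_e.
have [f f_es fE] : exists2 f, f \in es &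
    forall g : 'I_(nv H) * 'I_(nv H) -> nat, nth 0 [seq g a | a <- es] e = g f.
  case: es lt_e => // a es' lt_e.
  exists (nth a (a :: es') e); first exact: mem_nth.
  by move=> g; rewrite (nth_map a).
exists f.1, f.2; rewrite /= !fE; split=> //.
by move: f_es; rewrite es_arcs.2 inE.
Qed.

Lemma input_arcs (y z : 'I_(nv H)) : Defs.arc y z -> exists2 e, e < m &
  [/\ arrs s0 0 e = y, arrs s0 1 e = z & arrs s0 2 e = wt y z].
Proof.
move=> yz; have yz_es : (y, z) \in es by rewrite es_arcs.2 inE.
exists (index (y, z) es); first by rewrite index_mem.
by rewrite /= !(nth_map (y, z)) ?index_mem // !nth_index.
Qed.

Lemma hreach_arc x e k : e < m ->
  hreach x (arrs s0 0 e) k -> hreach x (arrs s0 1 e) (k + arrs s0 2 e).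
Proof.
move=> lt_e; have [y [z [yz -> -> ->]]] := input_arc lt_e.
move=> [y' /val_inj -> [p [px py <-]]]; exists z => //.
exists (rcons p z); rewrite rcons_path px py yz last_rcons; split=> //.
by rewrite -cats1 pairmap_cat sumn_cat /= py addn0.
Qed.

(** Soundness is [inv_D]. Conversely, with nothing pending, covered means visited, and this
    propagates along a walk of weight at most [r]. *)
Lemma search_complete (x : 'I_(nv H)) d D :
  search_inv m (arrs s0 0) (arrs s0 1) (arrs s0 2) r x (hreach x)
    [::] [::] [::] d D ->
  forall y : 'I_(nv H), D y <> None <-> hnear x y.
Proof.
move=> inv y; split.
- case Dy: (D y) => [k|] // _; have [[z /val_inj-> wz] le_kd] := inv_D inv Dy.
  by exists k => //; apply: leq_trans le_kd (inv_r inv).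
- move=> [k le_kr [p [px <- def_k]]].
  have [k0 Dx k0_le] : exists2 k0, D x = Some k0 & k0 <= 0.
    by case: (inv_src inv) => // [[]|[]].
  (* Bounding the recorded distance plus the weight still to go makes the induction on the walk
     work. *)
  have : k0 + sumn (pairmap (@wt H) x p) <= r by rewrite def_k; lia.
  elim: p (x) k0 px Dx {k0_le def_k} => [|z p IH] y0 k0 /=; first by move=> _ ->.
  move=> /andP[yz pz] Dy le_r.
  have [e lt_e [eT eH eW]] := input_arcs yz.
  have [||//|] := inv_arcs inv lt_e (k := k0).
  + by rewrite eT.
  + by rewrite eW; lia.
  + case=> // [[k1 Dz le_k1]|[]//|[]//].
    by apply: (IH z k1) => //; [rewrite -eH | move: le_k1; rewrite eW; lia].
Qed.

(** Scatteredness is stated in [G], where nearness is symmetric; marks are stated in the model,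
    whose other vertices get marked too. *)
Definition greedy_inv (s : state) : Prop :=
  exists ss : seq 'I_(nv H),
    [/\ [/\ uniq ss, {subset ss <= X}, size ss <= c
          & [seq val x | x <- ss] = mkseq (arrs s 0) (regs s 0)],
        forall x y, x \in ss -> y \in ss -> x != y -> ~ gnear x y,
        [/\ regs s 3 = size xs, regs s 4 = c & regs s 5 = r],
        [/\ arrs s 1 = arrs s0 1, arrs s 2 = arrs s0 2, arrs s 4 = arrs s0 4
          & forall v,
              chain (arrs s 6) (arrs s 5 v) (out_arcs (arrs s0 0) m v)]
      & (forall v, arrs s 7 v <= regs s 0) /\
        (forall y : 'I_(nv H),
           0 < arrs s 7 y <-> exists2 x, x \in ss & hnear x y)].

(** The potential reserves a full search for each vertex that may still be kept, and 40 for each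
    candidate left. *)
Definition greedy_state (n : nat) (s : state) : Prop :=
  [/\ greedy_inv s,
      regs s 0 = c \/ forall j, j < regs s 6 -> 0 < arrs s 7 (arrs s0 4 j),
      regs s 6 <= size xs,
      regs s 6 < size xs -> regs s 0 < c
    & 300 * ((c - regs s 0) * (m + nv H)) + 40 * (size xs - regs s 6) <= n].

Lemma input_subset j : j < size xs -> exists2 x, x \in X & arrs s0 4 j = val x.
Proof.
move=> lt_j.
have /(mem_nth 0) : j < size [seq val x | x <- xs] by rewrite size_map.
by case/mapP=> x xs_x def_j; exists x => //; rewrite -xs_X.2.
Qed.

Lemma greedy_inv_size s : greedy_inv s -> regs s 0 <= c.
Proof.
by case=> ss [[_ _ le_c /(congr1 size)]]; rewrite size_map size_mkseq => <-.
Qed.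

(** A marked candidate is near a kept vertex and is skipped; an unmarked one is far from all of
    them, and its own search marks it. The 20 pays for a skip. *)
Lemma greedy_select_runs s : greedy_inv s -> regs s 6 < size xs ->
  regs s 0 < c ->
  runs (If (TestEq (Arr 7 (Arr 4 (Reg 6))) (Cst 0))
      (Seq (Store 0 (Reg 0) (Arr 4 (Reg 6)))
      (Seq (Assign 0 (Succ (Reg 0)))
           (search_cmd (Arr 4 (Reg 6)))))
      Skip) s
    (fun t s' => [/\ greedy_inv s', regs s' 6 = regs s 6,
       forall v, 0 < arrs s 7 v -> 0 < arrs s' 7 v,
       0 < arrs s' 7 (arrs s0 4 (regs s 6))
     & t + 300 * ((c - regs s' 0) * (m + nv H))
         <= 300 * ((c - regs s 0) * (m + nv H)) + 20]).
Proof.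
move=> inv lt_i lt_c; have [x Xx def_x] := input_subset lt_i.
(* Hence [300 * nv H] absorbs the constant part of the cost of a search. *)
have nv_gt0 : 0 < nv H by apply: leq_ltn_trans (ltn_ord x).
have [ss [[Uss ssX _ ss_out] sc [s3 s4 s5] [s1 s2 sx ch] [le7 mark]]] := inv.
have size_ss : size ss = regs s 0.
  by move/(congr1 size): ss_out; rewrite size_map size_mkseq.
apply: runs_if => /=; rewrite sx def_x => h7; last first.
  apply: runs_skip; split=> //; last by lia.
  by move: def_x => /= ->; rewrite lt0n.
have x_far z : z \in ss -> ~ hnear z x.
  move=> ss_z zx; have /mark : exists2 z, z \in ss & hnear z x by exists z.
  by rewrite (eqP h7).
apply: runs_seq; apply: runs_store; apply: runs_seq; apply: runs_assign.
set s' := set_reg _ _ _.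
apply: (runs_mono (@search_runs m (arrs s0 0) s' x (hreach x) _ _ _ _ _ _ _)).
- by move=> e k; rewrite /= s1 s2; apply: hreach_arc.
- move=> e lt_e; rewrite /= s2; have [y [z [yz _ _ ->]]] := input_arc lt_e.
  exact: H01.
- exact: ch.
(* Register 0 is already incremented, so it exceeds all earlier marks. *)
- by move=> v; rewrite /= ltnS.
- by rewrite /= sx.
- by exists x => //; exists [::].
move=> t s'' [le_t [D [[fr fa] st] [d]]]; rewrite /= s1 s2 s5.
move=> /search_complete near_x.
have st_x : 0 < arrs s'' 7 x.
  have /near_x : hnear x x by apply: near_refl.
  by rewrite st; case: (D x).
split.
- exists (rcons ss x); split.
  + rewrite rcons_uniq Uss size_rcons size_ss fr //= fa //= andbT.
    split=> //.
    * by apply/negP=> /x_far; apply; apply: near_refl.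
    * by move=> y; rewrite mem_rcons inE => /predU1P[->|/ssX].
    * rewrite mkseqS eqxx map_rcons ss_out sx def_x; congr rcons.
      apply/eq_in_map=> j; rewrite mem_iota => /andP[_ lt_j].
      by rewrite ifN //; lia.
  + move=> y z; rewrite !mem_rcons !inE.
    have far y' : y' \in ss -> ~ gnear y' x.
      by move=> ss_y; rewrite -hnearE //; [apply: x_far | apply: ssX].
    move=> /predU1P[->|ss_y] /predU1P[->|ss_z] //; first by rewrite eqxx.
    (* Earlier searches started from [z], so a walk from [x] has to be reversed. *)
    * by move=> _ /near_adj_sym; apply: far.
    * by move=> _; apply: far.
    * exact: sc.
  + by rewrite !fr.
  + by rewrite !fa.
  + split.
    * by move=> v; rewrite st fr //=; case: (D v) => //; apply: leqW.
    * move=> y; rewrite st /=; split.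
      -- case Dy: (D y) => [k|] => [_|/mark[z ss_z zy]].
           exists x; first by rewrite mem_rcons mem_head.
           by apply/near_x; rewrite Dy.
         by exists z => //; rewrite mem_rcons inE ss_z orbT.
      -- case Dy: (D y) => [k|] // [z]; rewrite mem_rcons inE.
         move=> /predU1P[->|ss_z]; last by move=> zy; apply/mark; exists z.
         by move=> /near_x.
- by rewrite fr.
- by move=> v; rewrite st /=; case: (D v).
- by move: def_x => /= ->.
- rewrite fr //=.
  have -> : c - regs s 0 = (c - (regs s 0).+1).+1 by lia.
  rewrite mulSn mulnDr; move: le_t => /=; lia.
Qed.

Lemma greedy_step_runs n s : greedy_state n s -> regs s 6 < size xs ->
  runs greedy_step_cmd s (fun t s' =>
    exists2 n', 3 + t + n' <= n & greedy_state n' s').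
Proof.
move=> [inv marked le6 cnt le_n] lt_i.
apply: runs_seq; apply: (runs_mono (greedy_select_runs inv lt_i (cnt lt_i))).
move=> t s1 [inv1 s1_6 mono mark_i cost].
have le_c := greedy_inv_size inv1.
have [ss [f1 f2 [r3 r4 r5] f4 f5]] := inv1.
apply: runs_if => /=; rewrite r4 => hc; apply: runs_assign.
(* The 3 is for the loop test, and 10 bounds the cost of the second conditional. *)
- exists (n - 3 - t - 10); first by rewrite /=; lia.
  split=> /=; rewrite ?r3; [by exists ss|by left; apply/eqP|by []|by lia|by lia].
- exists (n - 3 - t - 10); first by rewrite /=; lia.
  split=> /=; rewrite ?s1_6; [by exists ss| |by []|by lia|by lia].
  right=> j; rewrite ltnS leq_eqVlt => /predU1P[->//|lt_j].
  apply: mono; case: marked => [eq_c|]; last by apply.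
  by have := cnt lt_i; lia.
Qed.

(** With [c] vertices kept, a larger set would be too big. Otherwise each [y] in a competing set [B]
    is near a kept [x], also in [B], and scatteredness forces them to be equal. *)
Lemma greedy_final s : greedy_inv s ->
  (regs s 0 = c \/ forall j, j < size xs -> 0 < arrs s 7 (arrs s0 4 j)) ->
  exists2 S : {set 'I_(nv H)}, outputs s S & maximal_scattered G X c r S.
Proof.
move=> [ss [[Uss ssX le_c ss_out] sc _ _ [_ mark]]] fin.
have size_ss : size ss = regs s 0.
  by move/(congr1 size): ss_out; rewrite size_map size_mkseq.
have card_S : #|[set x in ss]| = size ss by rewrite cardsE; apply/card_uniqP.
exists [set x in ss].
  by exists ss => //; split=> // x; rewrite inE.
apply/maxsetP; split.
  rewrite card_S le_c andbT; apply/andP; split.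
    by apply/subsetP=> x; rewrite inE => /ssX.
  apply/forall_inP=> x; rewrite inE => ss_x.
  apply/forall_inP=> y; rewrite inE => ss_y; apply/implyP=> xy.
  by apply/negPn/negP=> /dist_gtPn; apply: sc.
move=> B /and3P[BX scB cB] SB; apply/eqP.
rewrite eq_sym eqEsubset SB /=; apply/subsetP=> y By.
case: fin => [eq_c|marked].
  by have /eqP -> : [set x in ss] == B by rewrite eqEcard SB card_S size_ss eq_c.
have xs_y : y \in xs by rewrite xs_X.2 (subsetP BX).
have := marked (index y xs); rewrite index_mem /= (nth_map y) ?index_mem //.
rewrite nth_index // => /(_ xs_y) /mark[x ss_x xy].
case: (eqVneq x y) => [<-|ne_xy]; first by rewrite inE.
have Bx : x \in B by apply: (subsetP SB); rewrite inE.
move: scB => /forall_inP/(_ x Bx)/forall_inP/(_ y By)/implyP/(_ ne_xy).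
by move/negPn/negP; case; apply/dist_gtPn/hnearE => //; apply: (subsetP BX).
Qed.

Lemma greedy_runs : runs greedy_cmd s0 (fun t s =>
  t <= 1000 * (c * (nv H + m)).+1 /\
  exists2 S : {set 'I_(nv H)}, outputs s S & maximal_scattered G X c r S).
Proof.
have le_xs : size xs <= nv H.
  by have := max_card (mem xs); rewrite card_ord (card_uniqP xs_X.1).
apply: runs_seq; apply: runs_assign; apply: runs_if => /= c_gt0; last first.
  apply: runs_skip; split; first by lia.
  have c0 : c = 0 by lia.
  exists set0; first by exists [::] => //; split=> // x; rewrite !inE.
  apply/maxsetP; split.
    rewrite sub0set cards0 leq0n andbT /=; apply/forall_inP=> x.
    by rewrite inE.
  move=> B /and3P[_ _]; rewrite c0 leqn0 cards_eq0 => /eqP-> //.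
apply: runs_seq; set s1 := set_reg _ _ _.
have s1_5 v : arrs s1 5 v = 0 by rewrite /= nth_nil.
apply: (runs_mono (build_runs (erefl : regs s1 6 = 0) s1_5)).
move=> t1 s2 [/= le_t1 fr fa ch].
apply: runs_seq; apply: runs_assign; set s3 := set_reg _ _ _.
have inv3 : greedy_inv s3.
  exists [::]; split=> //=; rewrite ?fr //; first by split=> //; rewrite fa.
  by split=> [v|y]; rewrite ?fa //= nth_nil //; split=> // -[].
have I3 : greedy_state (300 * (c * (m + nv H)) + 40 * size xs) s3.
  by split=> //=; rewrite ?fr //= ?subn0 //; right.
apply: (runs_mono (runs_while I3 _ _)) => //=.
  move=> n s Is h6; apply: greedy_step_runs => //.
  by have [[ss [_ _ [<- _ _] _ _]] _ _ _ _] := Is.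
move=> t s [le_t [n [inv marked le6 _ _]]] h6; split.
  (* As [c] is positive, building the lists and scanning [X], both linear, fit in the bound. *)
  have : m + nv H <= c * (m + nv H) by rewrite leq_pmull.
  rewrite [nv H + m]addnC; lia.
apply: greedy_final => //; case: marked => [|marked]; [by left | right=> j lt_j].
apply: marked; have [ss [_ _ [r3 _ _] _ _]] := inv; lia.
Qed.

End Greedy.

Theorem lemma7p3 :
  exists (p : cmd) (K : nat),
    forall (H : wdigraph) (G : graph 'I_(nv H)),
      weights01 H -> distance_model H G ->
    forall (c r : nat) (X : {set 'I_(nv H)}), X \subset vset G ->
    forall (es : seq ('I_(nv H) * 'I_(nv H))) (vs xs : seq 'I_(nv H)),
      enumerates es (arcs H) -> enumerates vs (vset G) -> enumerates xs X ->
    exists (t : nat) (s : state) (S : {set 'I_(nv H)}),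
      [/\ exec p (input_state es vs xs c r) t s,
          t <= K * (c * wdigraph_size H).+1,
          outputs s S
        & maximal_scattered G X c r S].
Proof.
exists greedy_cmd, 1000 => H G H01 HG c r X XG es vs xs es_arcs _ xs_X.
have size_es : #|arcs H| = size es.
  by rewrite -(eq_card es_arcs.2); apply/card_uniqP; case: es_arcs.
have [t [s [ex [le_t [S out maxS]]]]] :=
  greedy_runs H01 HG c r XG vs es_arcs xs_X.
by exists t, s, S; rewrite /wdigraph_size size_es.
Qed.
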